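(* Let $n\ge 3$ and $k=2$. Let $A\subset V^\ast\otimes_{\mathbb R}\mathbb S$ be the tableau associated to the $2$-Dirac operator $\partial=(\partial_1,\partial_2)$ acting on $\mathbb S$-valued functions on $M(n,2,\mathbb R)$. Then its first prolongation $A^{(1)}$, regarded as a tableau in $V^\ast\otimes_{\mathbb R} A$, is involutive.
   Context: Spinors: $\varepsilon_1,\dots,\varepsilon_n$ is an orthonormal basis of Euclidean $\mathbb R^n$, with Clifford relations $\varepsilon_\alpha\varepsilon_\beta+\varepsilon_\beta\varepsilon_\alpha=-2\delta_{\alpha\beta}$. $\mathbb S$ is the complex spinor module of $\mathfrak{so}(n)$: the unique spinor module if $n$ is odd, and the direct sum $\mathbb S_+\oplus\mathbb S_-$ of the two half-spinor modules if $n$ is even. Thus $s:=\dim_{\mathbb C}\mathbb S=2^m$ for $n=2m$ or $n=2m+1$, and $\mathbb R^n$ acts on $\mathbb S$ by Clifford multiplication. Operator: $M(n,k,\mathbb R)$ is the space of real $n\times k$ matrices with coordinates $x_{\alpha i}$, $1\le\alpha\le n$, $1\le i\le k$. The $k$-Dirac operator (in the Euclidean setting) is $\partial=(\partial_1,\dots,\partial_k)$, $\partial_i\psi=\sum_{\alpha=1}^n\varepsilon_\alpha\cdot\frac{\partial\psi}{\partial x_{\alpha i}}$, for $\mathbb S$-valued functions $\psi$. A monogenic spinor is a solution of $\partial\psi=0$. Tableau of the operator: $V^\ast$ is the real $nk$-dimensional vector space spanned by the linear coordinates $x_{\alpha i}$, and $A\subset V^\ast\otimes_{\mathbb R}\mathbb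 S$ is the complex space of linear monogenic spinors, i.e. $A=\{\sum x_{\alpha i}\otimes\psi_{\alpha i}:\ \sum_\alpha\varepsilon_\alpha\cdot\psi_{\alpha i}=0\text{ for every } i\}$. The prolongations are $A^{(0)}=A$ and $A^{(j)}=(S^{j+1}V^\ast\otimes\mathbb S)\cap(V^\ast\otimes A^{(j-1)})$ for $j\ge1$; $A^{(j)}$ is identified with the space of homogeneous monogenic spinors of degree $j+1$, and $(A^{(j)})^{(1)}\cong A^{(j+1)}$. Involutivity: a tableau is a complex subspace $B\subset V^\ast\otimes_{\mathbb R} W$, where $V^\ast$ is a real vector space of dimension $N$ and $W$ is a finite-dimensional complex vector space; all dimensions of tableaux are complex. Its first prolongation is $B^{(1)}=(S^2V^\ast\otimes W)\cap(V^\ast\otimes B)$. For an ordered basis $u^1,\dots,u^N$ of $V^\ast$ put $B_j=B\cap(\langle u^{j+1},\dots,u^N\rangle\otimes W)$. One always has $\dim B^{(1)}\le\dim B+\dim B_1+\dots+\dim B_{N-1}$, and $B$ is called involutive if equality holds for some ordered basis of $V^\ast$. *)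

(* Defs.v *)
From HB Require Import structures.
From mathcomp Require Import all_boot all_order all_algebra.
From mathcomp Require Import complex.
From mathcomp Require Import reals.

Set Implicit Arguments.
Unset Strict Implicit.
Unset Printing Implicit Defensive.

Import Order.TTheory GRing.Theory Num.Theory.
Local Open Scope ring_scope.
Local Open Scope complex_scope.

(* The real vector space V^* has a basis (x_i) indexed by the finite type I,  *)
(* so V^* is {ffun I -> R^o} and V^* (x)_R W is {ffun I -> W}: the function f *)
(* stands for the tensor \sum_i x_i (x) f i.                                  *)

Section Tableau.
Variables (R : realType) (I : finType).
Implicit Type W : vectType R[i].

Definition tens W (u : {ffun I -> R^o}) (w : W) : {ffun I -> W} :=
  [ffun i => (u i : R)%:C *: w].

Lemma tens_is_linear W u : linear (@tens W u).
Proof.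
move=> a v w; apply/ffunP=> i; rewrite !ffunE scalerDr !scalerA.
by rewrite [_ * a]mulrC.
Qed.

HB.instance Definition _ W u :=
  GRing.isLinear.Build R[i] W {ffun I -> W} _ (@tens W u)
    (tens_is_linear u).

(* <u_j, ..., u_(N-1)> (x) W. *)
Definition tail_tensor W (u : #|I|.-tuple {ffun I -> R^o}) (j : nat) :
    {vspace {ffun I -> W}} :=
  (\sum_(l < #|I| | (j <= l)%N) limg (linfun (@tens W (tnth u l))))%VS.

Definition skew_part W (B : {vspace {ffun I -> W}})
    (f : {ffun I -> subvs_of B}) : {ffun I * I -> W} :=
  [ffun p => vsval (f p.1) p.2 - vsval (f p.2) p.1].

Lemma skew_part_is_linear W (B : {vspace {ffun I -> W}}) :
  linear (@skew_part W B).
Proof.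
move=> a f g; apply/ffunP=> p.
by rewrite !ffunE !linearP scalerBr -scalerN addrACA.
Qed.

HB.instance Definition _ W (B : {vspace {ffun I -> W}}) :=
  GRing.isLinear.Build R[i] {ffun I -> subvs_of B} {ffun I * I -> W} _
    (@skew_part W B) (@skew_part_is_linear W B).

(* The first prolongation (S^2 V^* (x) W) :&: (V^* (x) B), as a subspace of   *)
(* V^* (x) B; it is thus itself a tableau, with B in place of W.              *)
Definition prolong W (B : {vspace {ffun I -> W}}) :
    {vspace {ffun I -> subvs_of B}} :=
  lker (linfun (@skew_part W B)).

Lemma mem_prolong W (B : {vspace {ffun I -> W}}) (f : {ffun I -> subvs_of B}) :
  reflect (forall i j, vsval (f i) j = vsval (f j) i) (f \in prolong B).
Proof.
rewrite memv_ker lfunE /=; apply: (iffP eqP) => [f0 i j | fsym].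
  by apply/eqP; rewrite -subr_eq0; have /ffunP/(_ (i, j)) := f0;
     rewrite !ffunE => ->.
by apply/ffunP=> -[i j]; rewrite !ffunE /= fsym subrr.
Qed.

Definition involutive_tableau W (B : {vspace {ffun I -> W}}) : Prop :=
  exists u : #|I|.-tuple {ffun I -> R^o},
    basis_of fullv u /\
    \dim (prolong B) = (\sum_(j < #|I|) \dim (B :&: tail_tensor W u j))%N.

End Tableau.

Section Spinors.
Variables (R : realType) (n : nat) (S : vectType R[i]).
Variable eps : 'I_n -> 'End(S).

Definition clifford_relations : Prop :=
  forall (a b : 'I_n) (v : S),
    eps a (eps b v) + eps b (eps a v) = (- 2 * (a == b)%:R : R[i]) *: v.

(* S is the spinor module with its Clifford multiplication: a simple complex  *)
(* Clifford module.  Over so(n), acting through the eps a \o eps b, it is the *)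
(* unique spinor module if n is odd and the sum of the two half-spinor        *)
(* modules if n is even.  For n odd there are two simple Clifford modules,    *)
(* which differ by eps |-> - eps and agree over so(n); both are allowed.      *)
Definition spinor_module : Prop :=
  [/\ clifford_relations,
      \dim {:S} != 0%N
    & forall U : {vspace S},
        (forall a, (eps a @: U <= U)%VS) -> U = 0%VS \/ U = fullv].

Variable k : nat.

(* The symbol of the k-Dirac operator: on psi(x) = \sum x_(a, i) f (a, i),    *)
(* the i-th component of the operator is constant, with the value below.      *)
Definition dirac_symbol (f : {ffun 'I_n * 'I_k -> S}) : {ffun 'I_k -> S} :=
  [ffun i => \sum_a eps a (f (a, i))].

Lemma dirac_symbol_is_linear : linear dirac_symbol.
Proof.
move=> c f g; apply/ffunP=> i; rewrite !ffunE scaler_sumr -big_split /=.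
by apply: eq_bigr => a _; rewrite !ffunE linearP.
Qed.

HB.instance Definition _ :=
  GRing.isLinear.Build R[i] {ffun 'I_n * 'I_k -> S} {ffun 'I_k -> S} _
    dirac_symbol dirac_symbol_is_linear.

Definition dirac_tableau : {vspace {ffun 'I_n * 'I_k -> S}} :=
  lker (linfun dirac_symbol).

Lemma mem_dirac_tableau (f : {ffun 'I_n * 'I_k -> S}) :
  reflect (forall i, \sum_a eps a (f (a, i)) = 0) (f \in dirac_tableau).
Proof.
rewrite memv_ker lfunE /=; apply: (iffP eqP) => [/ffunP f0 i | f0].
  by have := f0 i; rewrite !ffunE.
by apply/ffunP=> i; rewrite !ffunE f0.
Qed.

End Spinors.

(* Main.v *)
From HB Require Import structures.
Require Import Defs.
From mathcomp Require Import all_boot all_order all_algebra.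
From mathcomp Require Import complex.
From mathcomp Require Import reals.
From mathcomp Require Import zify.

(** Write [N = 2n] and [s = dim S].  The tableau [A^(1)] is the space of
    quadratic monogenic spinors and its prolongation is the space [M3] of cubic
    ones.  The theorem holds because [dim M3] can be bounded from both sides by
    numbers that agree.

    Lower bound.  If [f_i = D_i psi] then
    [D_2 D_1 f_1 = D_1^2 f_2] and [D_1 D_2 f_2 = D_2^2 f_1], since the square of
    a Dirac operator is minus a Laplacian, which commutes with everything.  For
    cubic [psi] these two conditions on [(f_1, f_2)] are valued in [S] and
    jointly surjective ([compat_dirac_poly], [compat_surj]), so the Dirac
    operator on cubics has rank at most [2 s 'C(N + 1, 2) - 2 s] and
    [dim M3 >= s ('C(N + 2, 3) - 2 'C(N + 1, 2) + 2)]
    ([dim_prolong2_dirac_ge]).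

    Upper bound.  Differentiating along the dual basis vectors one after the
    other gives the classical inequality of Cartan between [dim M3] and the sum
    of the dimensions of the [B_j], and the same argument one degree lower
    bounds each [B_j] by linear monogenics ([cartan_bound]).  It
    remains to find coordinates for which the spaces of monogenics
    in the last few variables are as small as possible.  Take as last three
    coordinates [y_3, x_1, x_2 + y_1], where [x] and [y] are the two columns
    of the matrix.  On functions of [w = y_3], [u = x_1] and [v = x_2 + y_1] the
    two equations become
    [psi_u = (e1 e2) psi_v] and [psi_v = (e1 e3) psi_w].  The linear solutions
    are determined by [psi_w], and as [e1 e2] and [e1 e3] anticommute, computing
    [psi_uv] in two ways shows that there is no quadratic solution
    ([three_variable_quadratic_eq0]); this is where three distinct indices,
    hence [3 <= n], are used.  Consequently
    [dim B_j <= s \sum_(j <= i < N - 3) (N - 2 - i)] ([dim_prolong_tail]).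

    The sum over [j] of the last bounds is exactly the lower bound for [dim M3]
    ([hilbert_function_identity]), so equality holds throughout. *)

Set Implicit Arguments.
Unset Strict Implicit.
Unset Printing Implicit Defensive.

(** * Dimension counts for linear maps *)

Section Dimensions.
Import GRing.Theory.
Local Open Scope ring_scope.
Variable F : fieldType.

Lemma dim_ffun (I : finType) (W : vectType F) :
  \dim {: {ffun I -> W}} = (#|I| * \dim {:W})%N.
Proof. by rewrite !dimvf. Qed.

Lemma dim_le_lker0 (U W : vectType F) (D : {vspace U}) (E : {vspace W})
    (g : 'Hom(U, W)) :
  (g @: D <= E)%VS -> (forall x, x \in D -> g x = 0 -> x = 0) ->
  (\dim D <= \dim E)%N.
Proof.
move=> gDE inj_g; apply: leq_trans (dimvS gDE).
rewrite -(limg_ker_dim g D) (_ : D :&: lker g = 0)%VS ?dimv0 //.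
apply/eqP; rewrite -subv0; apply/subvP=> x; rewrite memv_cap memv_ker memv0.
by case/andP=> Dx /eqP/(inj_g x Dx)->.
Qed.

(** The rank of [L] is at most the dimension of the kernel of [P], which is
    that of [V] less that of [W]. *)
Lemma dim_compl_le (U V W : vectType F) (L : 'Hom(U, V)) (P : 'Hom(V, W)) :
  (forall x, P (L x) = 0) -> (forall w, exists v, P v = w) ->
  (\dim {:U} + \dim {:W} <= \dim (lker L) + \dim {:V})%N.
Proof.
move=> PL surjP.
have <- := limg_ker_dim L fullv; have <- := limg_ker_dim P fullv.
rewrite !capfv (_ : P @: fullv = fullv)%VS; last first.
  apply/eqP; rewrite eqEsubv subvf; apply/subvP=> w _.
  by have [v <-] := surjP w; rewrite memv_img ?memvf.
rewrite -addnA leq_add2l leq_add2r dimvS //.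
by apply/subvP=> _ /memv_imgP[x _ ->]; rewrite memv_ker PL.
Qed.

End Dimensions.

(** * Cartan's inequality for a basis and its dual *)

Section CartanBound.
Import GRing.Theory.
Local Open Scope ring_scope.
Local Open Scope complex_scope.
Variables (R : realType) (I : finType).
Implicit Type W : vectType R[i].

(** The element [f] of [V^* (x) W], seen as a [W]-valued linear form, evaluated
    at [v]; equivalently, the derivative of [f] in the direction [v]. *)
Definition contr W (v : {ffun I -> R^o}) (f : {ffun I -> W}) : W :=
  \sum_i (v i : R)%:C *: f i.

Lemma contr_is_linear W v : linear (@contr W v).
Proof.
move=> a f g; rewrite /contr scaler_sumr -big_split /=; apply: eq_bigr => i _.
by rewrite !ffunE scalerDr !scalerA [a * _]mulrC.
Qed.

HB.instance Definition _ W v :=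
  GRing.isLinear.Build R[i] {ffun I -> W} W _ (@contr W v)
    (contr_is_linear v).

Lemma contr_tens W (v u : {ffun I -> R^o}) (w : W) :
  contr v (tens u w) = (\sum_i (u i : R) * v i)%:C *: w.
Proof.
rewrite /contr rmorph_sum scaler_suml; apply: eq_bigr => i _.
by rewrite ffunE scalerA -rmorphM mulrC.
Qed.

Variables (u e : #|I|.-tuple {ffun I -> R^o}).
Hypothesis dual_ue :
  forall l m, \sum_i (tnth u l i : R) * tnth e m i = (l == m)%:R.

(** One-sided inverses of square matrices are two-sided. *)
Lemma dual_bases_sum i k :
  \sum_l (tnth u l i : R) * tnth e l k = (i == k)%:R.
Proof.
pose U : 'M[R]_#|I| := \matrix_(l, p) tnth u l (enum_val p).
pose E : 'M[R]_#|I| := \matrix_(p, l) tnth e l (enum_val p).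
have UE : U *m E = 1%:M.
  apply/matrixP=> l m; rewrite !mxE -dual_ue [RHS]big_enum_val.
  by apply: eq_bigr => p _; rewrite !mxE.
have /matrixP/(_ (enum_rank k) (enum_rank i)) := mulmx1C UE.
rewrite !mxE (inj_eq enum_rank_inj) eq_sym => <-.
by apply: eq_bigr => l _; rewrite !mxE !enum_rankK mulrC.
Qed.

Lemma dual_bases_basis : basis_of fullv u.
Proof.
rewrite basisEfree subvf size_tuple dimvf /dim /= muln1 leqnn !andbT.
apply/freeP=> k /ffunP sum0 m.
transitivity (\sum_i (\sum_l k l *: tnth u l) i * (tnth e m i : R)).
  rewrite (eq_bigr (fun i => \sum_l k l * ((tnth u l i : R) * tnth e m i))).
    rewrite exchange_big /= (bigD1 m) //= -mulr_sumr dual_ue eqxx mulr1.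
    rewrite big1 ?addr0 // => l /negPf lm.
    by rewrite -mulr_sumr dual_ue lm mulr0.
  move=> i _; rewrite sum_ffunE mulr_suml; apply: eq_bigr => l _.
  by rewrite ffunE mulrA.
rewrite big1 // => i _; have := sum0 i; rewrite ffunE.
rewrite (eq_bigr (fun l => k l *: tnth u l)) => [->|l _].
  by rewrite mul0r.
by rewrite (tnth_nth 0).
Qed.

(** In the expansion [f = \sum_l u_l (x) f_l] the coefficient [f_l] is the
    derivative of [f] along [e_l]. *)
Lemma mem_tail_tensor W (f : {ffun I -> W}) j :
  reflect (forall l : 'I_#|I|, (l < j)%N -> contr (tnth e l) f = 0)
          (f \in tail_tensor W u j).
Proof.
apply: (iffP memv_sumP) => [[t t_in ->] l lj | f0].
  rewrite linear_sum big1 //= => m jm.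
  have /memv_imgP[w _ ->] := t_in m jm; rewrite lfunE /= contr_tens dual_ue.
  by rewrite -val_eqE gtn_eqF ?scale0r // (leq_trans lj).
exists (fun l => tens (tnth u l) (contr (tnth e l) f)) => [l _|].
  by rewrite -[tens _ _]lfunE memv_img ?memvf.
transitivity (\sum_l tens (tnth u l) (contr (tnth e l) f)).
  apply/ffunP=> i; rewrite sum_ffunE.
  under eq_bigr do rewrite ffunE /contr scaler_sumr.
  rewrite exchange_big /= (eq_bigr (fun k => ((i == k)%:R)%:C *: f k)).
    rewrite (bigD1 i) //= eqxx scale1r big1 ?addr0 // => k.
    by rewrite eq_sym => /negPf->; rewrite scale0r.
  move=> k _; under eq_bigr do rewrite scalerA -rmorphM.
  by rewrite -scaler_suml -rmorph_sum dual_bases_sum.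
rewrite (bigID (fun l : 'I_#|I| => (j <= l)%N)) /= [X in _ + X]big1 ?addr0 //.
by move=> l; rewrite -ltnNge => /f0->; apply/ffunP=> i; rewrite !ffunE scaler0.
Qed.

(** Differentiation along [e_j] maps the [j]-th tail of the prolongation into
    the [j]-th tail of [B], by symmetry, and its kernel is the next tail. *)
Lemma cartan_step W (B : {vspace {ffun I -> W}}) (j : 'I_#|I|) :
  (\dim (prolong B :&: tail_tensor _ u j) <=
     \dim (prolong B :&: tail_tensor _ u j.+1)
       + \dim (B :&: tail_tensor _ u j))%N.
Proof.
pose g := linfun (vsval \o @contr (subvs_of B) (tnth e j)).
have gE f : g f = \sum_i (tnth e j i : R)%:C *: vsval (f i).
  by rewrite lfunE /= /contr linear_sum; apply: eq_bigr => i _; rewrite linearZ.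
rewrite -(limg_ker_dim g); apply: leq_add; apply: dimvS; apply/subvP=> f.
  case/memv_capP=> /memv_capP[Pf /mem_tail_tensor f0].
  rewrite memv_ker lfunE /= => /eqP gf0.
  apply/memv_capP; split=> //; apply/mem_tail_tensor=> l.
  rewrite ltnS leq_eqVlt => /predU1P[/val_inj-> | /f0//].
  by apply: subvs_inj; rewrite gf0 raddf0.
case/memv_imgP=> h /memv_capP[/mem_prolong h_sym /mem_tail_tensor h0] ->.
apply/memv_capP; split.
  by rewrite lfunE subvsP.
apply/mem_tail_tensor=> l lj; rewrite gE linear_sum big1 //= => i _.
rewrite linearZ /= (_ : contr _ _ = vsval (contr (tnth e l) h) i).
  by rewrite h0 // ffunE scaler0.
rewrite /contr linear_sum sum_ffunE; apply: eq_bigr => k _.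
by rewrite linearZ ffunE /= h_sym.
Qed.

Lemma tail_tensor_last W : tail_tensor W u #|I| = 0%VS.
Proof.
by rewrite /tail_tensor big_pred0 // => l; rewrite leqNgt ltn_ord.
Qed.

Lemma cartan_bound W (B : {vspace {ffun I -> W}}) (j p : nat) :
  (j <= p <= #|I|)%N ->
  (\dim (prolong B :&: tail_tensor _ u j) <=
     \dim (prolong B :&: tail_tensor _ u p)
       + \sum_(j <= l < p) \dim (B :&: tail_tensor _ u l))%N.
Proof.
case/andP=> jp; rewrite -(subnKC jp); elim: (p - j)%N => [|d IHd] jd.
  by rewrite addn0 big_geq // addn0.
rewrite addnS in jd *; apply: leq_trans (IHd (ltnW jd)) _.
rewrite big_nat_recr ?leq_addr //= addnA [leqRHS]addnAC leq_add2r.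
exact: cartan_step (Ordinal jd).
Qed.

Lemma cartan_inequality W (B : {vspace {ffun I -> W}}) :
  (\dim (prolong B) <= \sum_(l < #|I|) \dim (B :&: tail_tensor _ u l))%N.
Proof.
have := @cartan_bound W B 0 #|I|; rewrite leqnn => /(_ isT).
rewrite tail_tensor_last capv0 dimv0 add0n big_mkord; apply: leq_trans.
by apply/dimvS/subvP=> f; rewrite memv_cap => ->; apply/mem_tail_tensor.
Qed.

End CartanBound.

Section ContractionFamily.
Import GRing.Theory.
Local Open Scope ring_scope.
Variables (R : realType) (I T : finType) (W : vectType R[i]).
Variable v : T -> {ffun I -> R^o}.

Definition contr_family (f : {ffun I -> W}) : {ffun T -> W} :=
  [ffun t => contr (v t) f].

Lemma contr_family_is_linear : linear contr_family.
Proof. by move=> k f g; apply/ffunP=> t; rewrite !ffunE linearP. Qed.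

HB.instance Definition _ :=
  GRing.isLinear.Build R[i] {ffun I -> W} {ffun T -> W} _ contr_family
    contr_family_is_linear.

(** An element of [D] that is determined by its derivatives along the [v t]
    depends on at most [#|T|] values in [W]. *)
Lemma dim_le_contr (D : {vspace {ffun I -> W}}) :
  (forall f, f \in D -> (forall t, contr (v t) f = 0) -> f = 0) ->
  (\dim D <= #|T| * \dim {:W})%N.
Proof.
move=> D0; rewrite -dim_ffun.
apply: (@dim_le_lker0 _ _ _ _ _ (linfun contr_family)); first exact: subvf.
move=> f Df; rewrite lfunE => /ffunP f0; apply: D0 => // t.
by have := f0 t; rewrite !ffunE.
Qed.

End ContractionFamily.

(** * Clifford calculus *)

Section Double.
Import GRing.Theory Num.Theory.
Local Open Scope ring_scope.

Lemma double_inj (F : numFieldType) (V : lmodType F) (v w : V) :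
  v + v = w + w -> v = w.
Proof.
rewrite -(mulr2n v) -(mulr2n w) -!(scaler_nat 2) => /eqP.
rewrite -subr_eq0 -scalerBr scaler_eq0.
by rewrite pnatr_eq0 /= subr_eq0 => /eqP.
Qed.

End Double.

Section Clifford.
Import GRing.Theory Num.Theory.
Local Open Scope ring_scope.
Local Open Scope complex_scope.
Variables (R : realType) (n : nat) (S : vectType R[i]) (eps : 'I_n -> 'End(S)).
Hypothesis eps_clifford : clifford_relations eps.

Lemma clifford_sqr a v : eps a (eps a v) = - v.
Proof.
apply: double_inj; rewrite eps_clifford eqxx mulr1 scaleNr.
by rewrite scaler_nat mulr2n opprD.
Qed.

Lemma clifford_anticomm a b v : a != b -> eps a (eps b v) = - eps b (eps a v).
Proof.
move=> /negPf ab; apply/eqP; rewrite -addr_eq0 eps_clifford ab mulr0.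
by rewrite scale0r.
Qed.

Lemma clifford_inj a : injective (eps a).
Proof.
by move=> v w vw; apply: oppr_inj; rewrite -!(clifford_sqr a) vw.
Qed.

Lemma clifford_eq0 a v : eps a v = 0 -> v = 0.
Proof. by move=> v0; apply: (@clifford_inj a); rewrite linear0. Qed.

Lemma clifford_solve a b v w :
  eps a v + eps b w = 0 -> v = eps a (eps b w).
Proof.
move/eqP; rewrite addr_eq0 => /eqP eq_vw; apply: oppr_inj.
by rewrite -(clifford_sqr a) eq_vw linearN.
Qed.

(** The square of a Dirac operator is minus a Laplacian: only the
    symmetric part of the product of two generators survives. *)
Lemma clifford_sum_sym (G : 'I_n -> 'I_n -> S) :
  (forall a b, G a b = G b a) ->
  \sum_a \sum_b eps a (eps b (G a b)) = - \sum_a G a a.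
Proof.
move=> symG; apply: double_inj; rewrite {1}exchange_big /= -big_split /=.
rewrite -!sumrN -big_split; apply: eq_bigr => a _; rewrite -big_split /=.
rewrite (bigD1 a) //= !clifford_sqr big1 ?addr0 // => b ba.
by rewrite symG (clifford_anticomm _ ba) addNr.
Qed.

End Clifford.

(** * Coordinates adapted to the 2-Dirac operator *)

Section AdaptedBasis.
Import GRing.Theory Num.Theory.
Local Open Scope ring_scope.
Local Open Scope complex_scope.
Variables (R : realType) (n : nat) (S : vectType R[i]) (eps : 'I_n -> 'End(S)).
Hypothesis eps_clifford : clifford_relations eps.
Variables a b c : 'I_n.
Hypotheses (ab : a != b) (ac : a != c) (bc : b != c).

Local Notation I := ('I_n * 'I_2)%type.
Local Notation N := #|{: I}|.
Let x1 : I := (a, 0).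
Let x2 : I := (b, 0).
Let y1 : I := (a, 1).
Let y3 : I := (c, 1).
Local Notation A := (dirac_tableau eps 2).

(** As a linear function on the space of matrices, [f] factors through the three
    coordinates [y_3], [x_1] and [x_2 + y_1]. *)
Definition three_variable (W : vectType R[i]) (f : {ffun I -> W}) :=
  (forall i, i \notin [:: y3; x1; x2; y1] -> f i = 0) /\ f y1 = f x2.

(** On functions of the three coordinates the two Dirac equations have two
    terms each and can be solved for the derivatives along [x1] and [x2]. *)
Lemma three_variable_monogenic (f : {ffun I -> S}) :
    three_variable f -> f \in A ->
  f x1 = eps a (eps b (f x2)) /\ f x2 = eps a (eps c (f y3)).
Proof.
move=> [f0 fy1] /mem_dirac_tableau Af; split; apply: clifford_solve => //.
  rewrite -(Af 0) (bigD1 a) // (bigD1 b) 1?eq_sym //= big1 ?addr0 // => k.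
  case/andP=> ka kb; rewrite f0 ?linear0 // !inE !xpair_eqE.
  by rewrite (negPf ka) (negPf kb) andbF.
rewrite -fy1 -(Af 1) (bigD1 a) // (bigD1 c) 1?eq_sym //= big1 ?addr0 // => k.
case/andP=> ka kc; rewrite f0 ?linear0 // !inE !xpair_eqE.
by rewrite (negPf ka) (negPf kc) !andbF.
Qed.

Lemma three_variable_linear_eq0 (f : {ffun I -> S}) :
  three_variable f -> f \in A -> f y3 = 0 -> f = 0.
Proof.
move=> rf Af f_y3; have [f0 fy1] := rf; apply/ffunP=> i; rewrite ffunE.
have [fx1_eq fx2_eq] := three_variable_monogenic rf Af.
have fx2 : f x2 = 0 by rewrite fx2_eq f_y3 !linear0.
have fx1 : f x1 = 0 by rewrite fx1_eq fx2 !linear0.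
have [|/f0//] := boolP (i \in [:: y3; x1; x2; y1]).
by rewrite !inE => /or4P[] /eqP->; rewrite ?fy1.
Qed.

(** Two ways to express the mixed derivative along [x1] and [x2] through the
    one along [y3] and [x2] differ by a sign, because [eps b] and [eps c]
    anticommute; so that derivative vanishes, and with it all the others. *)
Lemma three_variable_quadratic_eq0 (g : {ffun I -> subvs_of A}) :
  g \in prolong A -> three_variable g -> g = 0.
Proof.
move=> /mem_prolong g_sym [g0 gy1]; pose F i j := vsval (g i) j.
have rF i : three_variable (vsval (g i)).
  split=> [j j_out|]; first by rewrite g_sym g0 // linear0 ffunE.
  by rewrite -!(g_sym _ i) gy1.
have F1 i : F i x1 = eps a (eps b (F i x2)).
  by have [] := three_variable_monogenic (rF i) (subvsP _).
have F2 i : F i x2 = eps a (eps c (F i y3)).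
  by have [] := three_variable_monogenic (rF i) (subvsP _).
have F33 : F y3 y3 = 0.
  have Fsym i j : F i j = F j i by apply: g_sym.
  (* All coefficients are Clifford multiples of r, F x1 x2 in two ways. *)
  pose r := F y3 x2.
  have F_12 : F x1 x2 = eps a (eps c (eps a (eps b r))) by rewrite F2 Fsym F1.
  have F_21 : F x1 x2 = eps a (eps b (eps a (eps c r))).
    by rewrite Fsym F1 F2 (Fsym x2).
  have eps3r : - eps c (eps b (eps a r)) = eps c (eps b (eps a r)).
    rewrite -linearN -(clifford_anticomm eps_clifford r ab).
    rewrite [RHS](clifford_anticomm eps_clifford) 1?eq_sym // -linearN.
    rewrite -(clifford_anticomm eps_clifford r ac).
    by apply: (clifford_inj eps_clifford (a := a)); rewrite -F_12 F_21.
  have {eps3r} : eps c (eps b (eps a r)) = 0.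
    by apply: double_inj; rewrite addr0 -{1}eps3r addNr.
  by rewrite /r F2; do 5!move/(clifford_eq0 eps_clifford).
apply/ffunP=> i; rewrite ffunE; apply: subvs_inj; rewrite linear0.
apply: three_variable_linear_eq0 (rF i) (subvsP _) _.
rewrite g_sym; suff ->: g y3 = 0 by rewrite linear0 ffunE.
apply: subvs_inj; rewrite raddf0.
exact: three_variable_linear_eq0 (rF y3) (subvsP _) F33.
Qed.

(* [y3] leads because the derivatives of a linear monogenic along the other two
   directions are read off from the one along [y3]. *)
Let special : seq I := [:: y3; x1; x2].

Lemma special_uniq : uniq special.
Proof. by rewrite /= !inE !xpair_eqE !andbF (negPf ab). Qed.

Lemma adapted_perm :
  perm_eq ([seq i <- enum {: I} | i \notin special] ++ special) (enum {: I}).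
Proof.
apply: uniq_perm; last 1 first.
- by move=> i; rewrite mem_cat mem_filter !mem_enum; case: (i \in special).
- rewrite cat_uniq filter_uniq ?enum_uniq // special_uniq andbT.
  by apply/hasPn=> i i_sp; rewrite mem_filter /= i_sp.
exact: enum_uniq.
Qed.

Lemma adapted_order_subproof :
  size ([seq i <- enum {: I} | i \notin special] ++ special) == N.
Proof. by rewrite (perm_size adapted_perm) -cardE. Qed.

Definition adapted_order : N.-tuple I := Tuple adapted_order_subproof.

Lemma adapted_order_uniq : uniq adapted_order.
Proof. by rewrite (perm_uniq adapted_perm) enum_uniq. Qed.

Lemma mem_adapted_order i : i \in adapted_order.
Proof. by rewrite (perm_mem adapted_perm) mem_enum. Qed.

(** Replacing the coordinate [x2] by [x2 + y1] changes the dual basis in the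
    direction [y1] only. *)
Definition adapted_vec (i : I) : {ffun I -> R^o} :=
  [ffun k => (k == i)%:R + ((i == x2) && (k == y1))%:R].

Definition adapted_covec (i : I) : {ffun I -> R^o} :=
  [ffun k => (k == i)%:R - ((i == y1) && (k == x2))%:R].

Lemma contr_adapted_covec (W : vectType R[i]) i (f : {ffun I -> W}) :
  contr (adapted_covec i) f = f i - (i == y1)%:R *: f x2.
Proof.
have delta k : \sum_j ((j == k)%:R : R)%:C *: f j = f k.
  rewrite (bigD1 k) //= eqxx scale1r big1 ?addr0 // => j /negPf->.
  by rewrite scale0r.
rewrite -(delta x2) scaler_sumr -[in RHS](delta i) -sumrB.
apply: eq_bigr => j _; rewrite ffunE rmorphB scalerBl scalerA -mulnb natrM.
by rewrite rmorphM !rmorph_nat.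
Qed.

Definition adapted_basis := map_tuple adapted_vec adapted_order.
Definition adapted_dual := map_tuple adapted_covec adapted_order.

Lemma adapted_basis_dual l m :
  \sum_i (tnth adapted_basis l i : R) * tnth adapted_dual m i = (l == m)%:R.
Proof.
rewrite !tnth_map -(inj_eq (tuple_uniqP _ adapted_order_uniq)).
set p := tnth _ l; set q := tnth _ m.
have delta (h : I -> R) k : \sum_j h j * (j == k)%:R = h k.
  rewrite (bigD1 k) //= eqxx mulr1 big1 ?addr0 // => j /negPf->.
  by rewrite mulr0.
under eq_bigr do rewrite [adapted_covec q _]ffunE mulrBr -mulnb natrM.
under eq_bigr do rewrite mulrCA.
rewrite sumrB -mulr_sumr !delta !ffunE (_ : (x2 == y1) = false); last first.
  by rewrite xpair_eqE andbF.
by rewrite andbF addr0 [x2 == p]eq_sym [q == p]eq_sym -natrM mulnb andbC addrK.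
Qed.

Lemma contr_tail (W : vectType R[i]) (f : {ffun I -> W}) j i :
  f \in tail_tensor W adapted_basis j ->
  (index i adapted_order < j)%N -> contr (adapted_covec i) f = 0.
Proof.
move/(mem_tail_tensor adapted_basis_dual) => f0 ij.
have /tnthP[l il] := mem_adapted_order i.
rewrite il -[adapted_covec _](tnth_map _ adapted_order) f0 //.
move: ij; rewrite il (tnth_nth x1) index_uniq ?adapted_order_uniq //.
by rewrite size_tuple.
Qed.

Lemma card_adapted : N = (size [seq i <- enum {: I} | i \notin special] + 3)%N.
Proof. by rewrite -(size_tuple adapted_order) size_cat. Qed.

Lemma index_adapted i :
  index i adapted_order =
    if i \in special then (N - 3 + index i special)%N
    else index i [seq i <- enum {: I} | i \notin special].
Proof.
rewrite index_cat mem_filter mem_enum andbT card_adapted addnK.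
by case: (i \in special).
Qed.

Lemma index_adapted_lt i : i \notin special ->
  (index i adapted_order < N - 3)%N.
Proof.
move=> i_sp; rewrite index_adapted (negPf i_sp) card_adapted addnK index_mem.
by rewrite mem_filter i_sp mem_enum.
Qed.

Lemma index_y3 : index y3 adapted_order = (N - 3)%N.
Proof. by rewrite index_adapted inE eqxx /= eqxx addn0. Qed.

Lemma three_variable_contr (W : vectType R[i]) (f : {ffun I -> W}) :
  (forall i, i \notin special -> contr (adapted_covec i) f = 0) ->
  three_variable f.
Proof.
move=> f0; split=> [i|].
  rewrite -[[:: _; _; _; _]]/(special ++ [:: y1]) mem_cat negb_or mem_seq1.
  case/andP=> i_sp /negPf iy; have := f0 i i_sp.
  by rewrite contr_adapted_covec iy scale0r subr0.
have /f0 : y1 \notin special.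
  by rewrite !inE !xpair_eqE !andbF (negPf ac).
by rewrite contr_adapted_covec eqxx scale1r => /eqP; rewrite subr_eq0 => /eqP.
Qed.

(** A linear monogenic in the [l]-th tail is determined by its derivatives
    along the directions numbered from [l] to [N - 3], the last of which is that
    of [y3].  The other two special ones contribute nothing, so the bound is
    [0] from [N - 2] on. *)
Lemma dim_dirac_tail l :
  (\dim (A :&: tail_tensor S adapted_basis l)
     <= (N - 2 - l) * \dim {:S})%N.
Proof.
rewrite -[X in (X * _)%N]card_ord.
pose v (t : 'I_(N - 2 - l)) := adapted_covec (nth x1 adapted_order (l + t)).
apply: (dim_le_contr (v := v)) => f /memv_capP[Af /contr_tail f0] v0.
have {v0} f0 i : (index i adapted_order < N - 2)%N ->
    contr (adapted_covec i) f = 0.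
  have [/f0// | le_li lt_i] := ltnP (index i adapted_order) l.
  have lt_t : (index i adapted_order - l < N - 2 - l)%N by lia.
  have := v0 (Ordinal lt_t); rewrite /v /= subnKC // nth_index //.
  exact: mem_adapted_order.
have I_ge3 : (2 < N)%N by rewrite card_adapted; lia.
apply: three_variable_linear_eq0 Af _.
  by apply: three_variable_contr => i /index_adapted_lt i_lt; apply: f0; lia.
have := f0 y3; rewrite contr_adapted_covec index_y3 xpair_eqE.
by rewrite [c == a]eq_sym (negPf ac) scale0r subr0; apply; lia.
Qed.

Lemma prolong_tail_eq0 :
  (prolong A :&: tail_tensor _ adapted_basis (N - 3)%N)%VS = 0%VS.
Proof.
apply/eqP; rewrite -subv0; apply/subvP=> g /memv_capP[Ag g_tail].
rewrite memv0; apply/eqP/three_variable_quadratic_eq0 => //.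
by apply: three_variable_contr => i /index_adapted_lt/(contr_tail g_tail).
Qed.

(** Cartan's bound in terms of linear monogenics, stopped at the tail of the
    three special coordinates: there is no quadratic monogenic left there, which
    saves the last terms of the sum. *)
Lemma dim_prolong_tail l :
  (\dim (prolong A :&: tail_tensor _ adapted_basis l)
     <= (\sum_(l <= i < N - 3) (N - 2 - i)) * \dim {:S})%N.
Proof.
have [l_lt | l_ge] := ltnP l (N - 3).
  have l_bnd : (l <= N - 3 <= N)%N by rewrite (ltnW l_lt) leq_subr.
  apply: leq_trans (cartan_bound adapted_basis_dual _ l_bnd) _.
  rewrite prolong_tail_eq0 dimv0 add0n big_distrl /=.
  by apply: leq_sum => i _; apply: dim_dirac_tail.
rewrite big_geq // leqn0 dimv_eq0 -subv0 -prolong_tail_eq0.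
apply: capvS => //; apply/subvP=> f.
move/(mem_tail_tensor adapted_basis_dual) => f0.
apply/(mem_tail_tensor adapted_basis_dual) => m m_lt.
by apply: f0; apply: leq_trans l_ge.
Qed.

End AdaptedBasis.

(** * Monomials as sorted tuples *)

Section Monomials.
Variable I : finType.
Implicit Type d : nat.

(** A monomial of degree [d] is a multiset of [d] variables, represented by its
    sorted enumeration, so that the monomials can be counted. *)
Definition monomial d := {t : d.-tuple 'I_#|I| | sorted leq (map val t)}.

HB.instance Definition _ d := SubFinite.on (monomial d).

Let leI : rel 'I_#|I| := relpre val leq.

Let leI_total : total leI. Proof. by move=> i j; apply: leq_total. Qed.
Let leI_trans : transitive leI. Proof. by move=> j i k; apply: leq_trans. Qed.
Let leI_anti : antisymmetric leI.
Proof. by move=> i j ij; apply/val_inj/anti_leq. Qed.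

Lemma mono_subproof d (s : d.-tuple I) :
  sorted leq (map val (sort_tuple leI (map_tuple enum_rank s))).
Proof. by rewrite sorted_map sort_sorted. Qed.

Definition mono d (s : d.-tuple I) : monomial d :=
  Sub (sort_tuple leI (map_tuple enum_rank s) : d.-tuple _) (mono_subproof s).

Definition letters d (t : monomial d) : d.-tuple I :=
  map_tuple enum_val (val t).

Lemma eq_mono d (s t : d.-tuple I) : (mono s == mono t) = perm_eq s t.
Proof.
rewrite -val_eqE -val_eqE /=.
apply/eqP/idP => [|/(perm_map enum_rank)/perm_sortP->//].
by move/perm_sortP=> st; apply: (perm_map_inj enum_rank_inj); apply: st.
Qed.

Lemma lettersK d : cancel (@letters d) (@mono d).
Proof.
move=> t; apply/val_inj/val_inj => /=.
rewrite -map_comp (eq_map (g := id)) => [|x]; last by rewrite /= enum_valK.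
by rewrite map_id sorted_sort // -sorted_map; case: t.
Qed.

Lemma perm_letters_mono d (s : d.-tuple I) : perm_eq (letters (mono s)) s.
Proof. by rewrite -eq_mono lettersK. Qed.

Lemma card_monomial d : (0 < #|I|)%N -> #|{: monomial d}| = 'C(d + #|I|.-1, d).
Proof.
rewrite card_sig -[RHS]card_sorted_tuples; case: #|I| => // m _ /=.
by apply: eq_card => t; rewrite !inE.
Qed.

End Monomials.

(** * Lower bound for the cubic monogenics *)

Section CubicMonogenics.
Import GRing.Theory Num.Theory.
Local Open Scope ring_scope.
Local Open Scope complex_scope.
Variables (R : realType) (n : nat) (S : vectType R[i]) (eps : 'I_n -> 'End(S)).
Hypothesis eps_clifford : clifford_relations eps.

Local Notation I := ('I_n * 'I_2)%type.
Local Notation A := (dirac_tableau eps 2).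

(** A homogeneous polynomial is given by its derivatives of top order, one for
    each monomial.  In these terms the Dirac operator needs no multiplicities:
    it adds a variable to the monomial and contracts with the Clifford
    generators. *)
Definition dirac_poly d (phi : {ffun monomial I d.+1 -> S}) :
    {ffun monomial I d * 'I_2 -> S} :=
  [ffun p => \sum_a eps a (phi (mono [tuple of (a, p.2) :: letters p.1]))].

Lemma dirac_poly_is_linear d : linear (@dirac_poly d).
Proof.
move=> k f g; apply/ffunP=> p; rewrite !ffunE scaler_sumr -big_split /=.
by apply: eq_bigr => a _; rewrite !ffunE linearP.
Qed.

HB.instance Definition _ d :=
  GRing.isLinear.Build R[i] {ffun monomial I d.+1 -> S}
    {ffun monomial I d * 'I_2 -> S} _ (@dirac_poly d) (@dirac_poly_is_linear d).

Lemma dirac_polyE d (phi : {ffun monomial I d.+1 -> S}) (s : d.-tuple I) c :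
  dirac_poly phi (mono s, c) =
    \sum_a eps a (phi (mono [tuple of (a, c) :: s])).
Proof.
rewrite ffunE; apply: eq_bigr => a _; congr (eps a (phi _)).
by apply/eqP; rewrite eq_mono /= perm_cons perm_letters_mono.
Qed.

(** The component at [c] of the obstruction to solving [D_c psi = h_c]: with
    [c'] the other index it is [D_c' D_c h_c - D_c^2 h_c']. *)
Definition compat (h : {ffun monomial I 2 * 'I_2 -> S}) : {ffun 'I_2 -> S} :=
  [ffun c => \sum_a \sum_b eps a (eps b
     (h (mono [tuple (a, rev_ord c); (b, c)], c)
      - h (mono [tuple (a, c); (b, c)], rev_ord c)))].

Lemma compat_is_linear : linear compat.
Proof.
move=> k f g; apply/ffunP=> c; rewrite !ffunE scaler_sumr -big_split /=.
apply: eq_bigr => a _; rewrite scaler_sumr -big_split /=.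
apply: eq_bigr => b _.
by rewrite !ffunE -!linearZ -!linearD /= scalerBr opprD addrACA.
Qed.

HB.instance Definition _ :=
  GRing.isLinear.Build R[i] {ffun monomial I 2 * 'I_2 -> S} {ffun 'I_2 -> S} _
    compat compat_is_linear.

(** Both terms equal minus the Laplacian in the variables of column [c] applied
    to [D_c' phi]. *)
Lemma compat_dirac_poly (phi : {ffun monomial I 3 -> S}) :
  compat (dirac_poly phi) = 0.
Proof.
pose F i j k := phi (mono [tuple i; j; k]).
have F_swap i j k : F i j k = F j i k.
  by congr (phi _); apply/eqP; rewrite eq_mono; apply/permP=> p /=; lia.
have F_rot i j k : F i j k = F j k i.
  by congr (phi _); apply/eqP; rewrite eq_mono; apply/permP=> p /=; lia.
have dphi i j c : dirac_poly phi (mono [tuple i; j], c) =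
    \sum_a eps a (F (a, c) i j).
  by rewrite dirac_polyE; apply: eq_bigr => a _; congr (eps a (phi (mono _))).
apply/ffunP=> c; rewrite !ffunE; set c' := rev_ord c.
under eq_bigr do under eq_bigr do rewrite !linearB.
under eq_bigr do rewrite sumrB.
rewrite sumrB; apply/eqP; rewrite subr_eq0; apply/eqP.
transitivity (- \sum_a \sum_b eps a (F (a, c') (b, c) (b, c))).
  rewrite -sumrN; apply: eq_bigr => a _.
  under eq_bigr do rewrite dphi !linear_sum /=.
  transitivity (eps a (\sum_i \sum_j eps i (eps j (F (a, c') (i, c) (j, c))))).
    rewrite linear_sum; apply: eq_bigr => i _.
    by rewrite linear_sum; apply: eq_bigr => j _; rewrite F_rot.
  rewrite (clifford_sum_sym eps_clifford) => [|i j].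
    by rewrite linearN linear_sum.
  by rewrite F_rot [RHS]F_swap F_rot.
rewrite (clifford_sum_sym eps_clifford) => [|i j]; last first.
  congr (dirac_poly phi (_, _)); apply/eqP.
  by rewrite eq_mono /= (perm_catC [:: _]).
by congr (- _); rewrite exchange_big; apply: eq_bigr => i _; rewrite dphi.
Qed.

(** Applied to the square of a single variable in the column [c], the term
    [D_c^2] gives a nonzero constant, while the monomials of [D_c' D_c] mix both
    columns. *)
Lemma compat_surj (a : 'I_n) (v : {ffun 'I_2 -> S}) : exists h, compat h = v.
Proof.
pose h := [ffun p : monomial I 2 * 'I_2 =>
  if p.1 == mono [tuple (a, rev_ord p.2); (a, rev_ord p.2)]
  then v (rev_ord p.2) else 0].
have rev_neq (c : 'I_2) : (c == rev_ord c) = false by case: c => [[|[|]]].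
have hc c x y : h (mono [tuple (x, rev_ord c); (y, c)], c) = 0.
  rewrite ffunE eq_mono; case: ifP => // /perm_mem/(_ (y, c)).
  by rewrite !inE eqxx orbT !xpair_eqE rev_neq !andbF.
have hc' c x y : h (mono [tuple (x, c); (y, c)], rev_ord c) =
    if (x == a) && (y == a) then v c else 0.
  rewrite ffunE eq_mono rev_ordK.
  case: (boolP (_ && _)) => [/andP[/eqP-> /eqP->]|xy].
    by rewrite perm_refl.
  case: ifP => // /perm_mem xy_a; move: (xy_a (x, c)) (xy_a (y, c)).
  rewrite !inE !xpair_eqE !eqxx !andbT !orbb orbT => /esym xa /esym ya.
  by rewrite xa ya in xy.
exists h; apply/ffunP=> c; rewrite ffunE.
under eq_bigr do under eq_bigr do rewrite hc hc' sub0r.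
rewrite (bigD1 a) //= [X in _ + X]big1 ?addr0 => [|x /negPf xa].
  rewrite (bigD1 a) //= big1 ?addr0 => [|y /negPf ya].
    by rewrite !eqxx (clifford_sqr eps_clifford) opprK.
  by rewrite ya andbF oppr0 !linear0.
by rewrite big1 // => y _; rewrite xa oppr0 !linear0.
Qed.

Definition coefs3 (f : {ffun I -> subvs_of (prolong A)}) :
    {ffun monomial I 3 -> S} :=
  [ffun t => let s := letters t in
     vsval (vsval (f (tnth s 0)) (tnth s 1)) (tnth s (inord 2))].

Lemma coefs3_is_linear : linear coefs3.
Proof.
move=> k f g; apply/ffunP=> t; rewrite !ffunE /=.
have ffunP_lin (V : lmodType R[i]) (u v : {ffun I -> V}) i :
  (k *: u + v) i = k *: u i + v i by rewrite !ffunE.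
by rewrite ffunP_lin linearP /= ffunP_lin linearP /= ffunP_lin.
Qed.

HB.instance Definition _ :=
  GRing.isLinear.Build R[i] {ffun I -> subvs_of (prolong A)}
    {ffun monomial I 3 -> S} _ coefs3 coefs3_is_linear.

(** Every cubic monogenic is the coefficient array of an element of the double
    prolongation. *)
Lemma dim_lker_dirac_le :
  (\dim (lker (linfun (@dirac_poly 2))) <= \dim (prolong (prolong A)))%N.
Proof.
apply: (@leq_trans (\dim (linfun coefs3 @: prolong (prolong A)))); last first.
  by rewrite -(limg_ker_dim (linfun coefs3) (prolong _)) leq_addl.
apply/dimvS/subvP=> phi; rewrite memv_ker lfunE => /eqP phi0.
have phi_perm (s t : 3.-tuple I) : perm_eq s t -> phi (mono s) = phi (mono t).
  by rewrite -eq_mono => /eqP->.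
pose Q i j : {ffun I -> S} := [ffun k => phi (mono [tuple k; i; j])].
have QA i j : Q i j \in A.
  apply/mem_dirac_tableau=> c; under eq_bigr do rewrite ffunE.
  have := dirac_polyE phi [tuple i; j] c.
  rewrite phi0 ffunE => sum0; rewrite [RHS]sum0.
  by apply: eq_bigr => a _; congr (eps a (phi (mono _))).
have Q_sym i j : Q i j = Q j i.
  by apply/ffunP=> k; rewrite !ffunE; apply/phi_perm/permP=> p /=; lia.
pose G i : {ffun I -> subvs_of A} := [ffun j => vsproj A (Q i j)].
have GE i j : vsval (G i j) = Q i j by rewrite ffunE vsprojK.
have GA i : G i \in prolong A.
  apply/mem_prolong=> j k; rewrite !GE !ffunE.
  by apply/phi_perm/permP=> p /=; lia.
pose f : {ffun I -> subvs_of (prolong A)} :=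
  [ffun i => vsproj (prolong A) (G i)].
have fE i : vsval (f i) = G i by rewrite [f i]ffunE; apply: vsprojK (GA i).
apply/memv_imgP; exists f.
  by apply/mem_prolong=> i j; rewrite !fE; apply: subvs_inj; rewrite !GE Q_sym.
apply/ffunP=> t; rewrite lfunE ffunE /= fE GE ffunE -[t in LHS]lettersK.
apply: phi_perm; case/tupleP: (letters t) => i s; case/tupleP: s => j s.
case/tupleP: s => k s; rewrite tuple0 /=.
by apply/permP=> p /=; rewrite !(tnth_nth i) /= inordK //=; lia.
Qed.

Lemma dim_prolong2_dirac_ge (a : 'I_n) :
  (('C(n * 2 + 2, 3) + 2) * \dim {:S} <=
     \dim (prolong (prolong A)) + (2 * 'C(n * 2 + 1, 2)) * \dim {:S})%N.
Proof.
have cardI : #|{: I}| = (n * 2)%N by rewrite card_prod !card_ord.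
have n_gt0 : (0 < n)%N by case: (n) a => [[]|].
have := dim_compl_le (L := linfun (@dirac_poly 2)) (P := linfun compat).
rewrite !dim_ffun card_prod !card_monomial cardI ?muln_gt0 ?n_gt0 // !card_ord.
have -> : (3 + (n * 2).-1 = n * 2 + 2)%N by lia.
have -> : (2 + (n * 2).-1 = n * 2 + 1)%N by lia.
rewrite -mulnDl [X in (_ + X * _)%N]mulnC => le_dim.
apply: leq_trans (le_dim _ _) _.
- by move=> phi; rewrite !lfunE /= compat_dirac_poly.
- by move=> v; have [h <-] := compat_surj a v; exists h; rewrite lfunE.
by rewrite leq_add2r dim_lker_dirac_le.
Qed.

End CubicMonogenics.

(** * Equality of the two bounds *)

Lemma sum_descending M j :
  (\sum_(j <= i < M) (M.+1 - i)).+1 = 'C(M - j + 2, 2).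
Proof.
have [jM|Mj] := leqP j M; last by rewrite big_geq ?(eqnP (ltnW Mj)) // ltnW.
rewrite -{1 2}(subnK jM); elim: (M - j) => [|r IHr]; first by rewrite big_geq.
rewrite addSn big_ltn ?ltnS ?leq_addl // big_add1 /=.
under eq_bigr do rewrite subSS.
have -> : (r + j).+2 - j = r.+2 by lia.
by rewrite -addnS IHr !addn2 [in RHS]binS bin1; lia.
Qed.

(** With the generating function [(1 + t) / (1 - t)^(N - 3)] of the monogenics
    written as [(1 - 2 t + 2 t^3 - t^4) / (1 - t)^N], both sides compute its
    coefficient at [t^3], up to the terms moved across. *)
Lemma hilbert_function_identity N : 3 <= N ->
  'C(N + 2, 3) + 2 = 2 * 'C(N + 1, 2) +
     \sum_(j < N) \sum_(j <= i < N - 3) (N - 2 - i).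
Proof.
move=> N_ge3; rewrite -(subnK N_ge3) addnK; set M := N - 3.
have -> : M + 3 - 2 = M.+1 by lia.
rewrite -(big_mkord xpredT (fun j => \sum_(j <= i < M) (M.+1 - i))).
rewrite (@big_cat_nat _ _ _ M) ?leq_addr //=.
rewrite [X in _ + (_ + X)]big_nat_cond.
rewrite [X in _ + (_ + X)]big1 ?addn0; last first.
  by move=> j /andP[/andP[Mj _] _]; rewrite big_geq.
rewrite big_mkord (reindex_inj rev_ord_inj) /=.
have -> : \sum_(j < M) \sum_(M - j.+1 <= i < M) (M.+1 - i) =
          \sum_(j < M) ('C(j + 3, 2)).-1.
  apply: eq_bigr => j _; rewrite -[LHS]/(_.+1.-1) sum_descending.
  by congr ('C(_, _)).-1; have := ltn_ord j; lia.
elim: M => [|m IHm]; first by rewrite big_ord0.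
rewrite big_ord_recr /=; have pascal p : 'C(p.+1, 2) = 'C(p, 2) + p.
  by rewrite binS bin1.
have [-> -> ->] : [/\ m.+1 + 3 + 2 = m.+3.+3, m.+1 + 3 + 1 = m.+4.+1
                    & m + 3 = m.+3] by split; lia.
have [e1 e2] : m + 3 + 2 = m.+4.+1 /\ m + 3 + 1 = m.+4 by split; lia.
move: IHm; rewrite e1 e2 (binS m.+4.+1 2) (pascal m.+4) (pascal m.+3).
have : 0 < 'C(m.+3, 2) by rewrite bin_gt0.
move: (\sum_(j < m) _) => G; lia.
Qed.

Theorem theorem1 (R : realType) (n : nat) (S : vectType (complex R))
    (eps : 'I_n -> 'End(S)) :
  (3 <= n)%N ->
  spinor_module eps ->
  involutive_tableau (prolong (dirac_tableau eps 2)).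
Proof.
move=> n_ge3 [eps_cl _ _].
pose a : 'I_n := Ordinal (ltnW (ltnW n_ge3)).
pose b : 'I_n := Ordinal (ltnW n_ge3); pose c : 'I_n := Ordinal n_ge3.
have [ab [ac bc]] : a != b /\ a != c /\ b != c by [].
have dual := @adapted_basis_dual R n a b c ab.
exists (adapted_basis R c ab); split; first exact: dual_bases_basis dual.
apply/eqP; rewrite eqn_leq; apply/andP; split.
  exact: (cartan_inequality dual (prolong (dirac_tableau eps 2))).
have N_eq : #|{: 'I_n * 'I_2}| = (n * 2)%N by rewrite card_prod !card_ord.
have := dim_prolong2_dirac_ge eps_cl a.
rewrite hilbert_function_identity; last by lia.
rewrite mulnDl addnC leq_add2r; apply: leq_trans.
rewrite big_distrl /= -N_eq; apply: leq_sum => j _.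
exact: dim_prolong_tail.
Qed.
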